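(* Let $\mathbb{U}_1$ and $\mathbb{U}_2$ be two 2-uninorms on $[0,1]$ with 2-neutral elements $\{e_1,f_1\}_{a_1}$ and $\{e_2,f_2\}_{a_2}$, respectively, let $\alpha\in[0,1]$, and put $\lambda=\mathbb{U}_2(\alpha,e_1)$ and $\mu=\mathbb{U}_2(\alpha,f_1)$. (i) If $\mathbb{U}_2(\alpha,e_1)\leq e_1$ and $\mathbb{U}_2(\alpha,f_1)\leq a_1$, then $\mathbb{U}_1$ is $(\alpha,\mathbb{U}_2)$-migrative if and only if $\mathbb{U}_1(\lambda,x)=\mathbb{U}_2(\alpha,x)$ for each $x\in[0,1]$. (ii) If $\mathbb{U}_2(\alpha,e_1)\leq e_1$ and $\mathbb{U}_2(\alpha,f_1)\geq a_1$, then $\mathbb{U}_1$ is $(\alpha,\mathbb{U}_2)$-migrative if and only if $$\mathbb{U}_2(\alpha,x)=\begin{cases}\mathbb{U}_1(\lambda,x), & x\in[0,a_1],\\ \mathbb{U}_1(\mu,x), & x\in[a_1,1]\end{cases}$$ and $\mathbb{U}_1(\lambda,x)=\mathbb{U}_1(a_1,x)$ for each $x\in[a_1,1]$. (iii) If $\mathbb{U}_2(\alpha,e_1)\in[e_1,a_1]$, then $\mathbb{U}_1$ is $(\alpha,\mathbb{U}_2)$-migrative if and only if $$\mathbb{U}_2(\alpha,x)=\begin{cases}\mathbb{U}_1(\lambda,x), & x\in[0,a_1],\\ \mathbb{U}_1(\mu,x), & x\in[a_1,1]\end{cases}$$ and $\mathbb{U}_1(\mu,x)=\mathbb{U}_1(a_1,x)$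 for each $x\in[0,a_1]$. (iv) If $\mathbb{U}_2(\alpha,e_1)\geq a_1$, then $\mathbb{U}_1$ is $(\alpha,\mathbb{U}_2)$-migrative if and only if $\mathbb{U}_1(\mu,x)=\mathbb{U}_2(\alpha,x)$ for each $x\in[0,1]$.
   Context: For a commutative binary operation $\mathbb{U}:[0,1]^2\to[0,1]$, $\{e,f\}_a$ with $0\leq e\leq a\leq f\leq 1$ is called a 2-neutral element of $\mathbb{U}$ if $\mathbb{U}(e,x)=x$ for all $x\in[0,a]$ and $\mathbb{U}(f,x)=x$ for all $x\in[a,1]$. A binary operation $\mathbb{U}:[0,1]^2\to[0,1]$ is a 2-uninorm if it is commutative, associative, increasing (i.e. non-decreasing) in both variables and has a 2-neutral element $\{e,f\}_a$. For 2-uninorms $\mathbb{U}_1,\mathbb{U}_2$ and $\alpha\in[0,1]$, $\mathbb{U}_1$ is called $(\alpha,\mathbb{U}_2)$-migrative if $\mathbb{U}_1(\mathbb{U}_2(\alpha,x),y)=\mathbb{U}_1(x,\mathbb{U}_2(\alpha,y))$ for all $x,y\in[0,1]$. When a case formula has overlapping pieces (here at $x=a_1$), both expressions are required to give the value. *)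

(* Defs.v *)
From mathcomp Require Import all_boot all_order all_algebra.
From mathcomp Require Import interval_inference reals.

Set Implicit Arguments.
Unset Strict Implicit.
Unset Printing Implicit Defensive.

Import Order.TTheory GRing.Theory Num.Theory.

Local Open Scope ring_scope.

(* [{i01 R}] is the type of elements of the closed interval [0, 1] of [R],
   with the order inherited from [R]: bounds such as 0 <= e and f <= 1 are
   carried by the type. *)

Definition increasing2 (R : realType) (U : {i01 R} -> {i01 R} -> {i01 R}) :=
  forall x y z : {i01 R}, x <= y -> U x z <= U y z /\ U z x <= U z y.

(* [two_neutral U e f a] : {e, f}_a is a 2-neutral element of [U]. Only the
   left-sided equations are imposed; the notion is used for commutative [U]. *)
Definition two_neutral (R : realType) (U : {i01 R} -> {i01 R} -> {i01 R})
    (e f a : {i01 R}) :=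
  [/\ e <= a <= f,
      forall x : {i01 R}, x <= a -> U e x = x
    & forall x : {i01 R}, a <= x -> U f x = x].

Definition two_uninorm (R : realType) (U : {i01 R} -> {i01 R} -> {i01 R}) :=
  [/\ commutative U, associative U, increasing2 U
    & exists e f a : {i01 R}, two_neutral U e f a].

(* [migrative alpha U2 U1] : [U1] is (alpha, U2)-migrative. *)
Definition migrative (R : realType) (alpha : {i01 R})
    (U2 U1 : {i01 R} -> {i01 R} -> {i01 R}) :=
  forall x y : {i01 R}, U1 (U2 alpha x) y = U1 x (U2 alpha y).

(* Main.v *)
(* Write g x = U2 alpha x; only the monotonicity of g matters. If U1 is
   migrative, then U1 (g e) y = U1 e (g y) = g y whenever g y <= a, and
   U1 (g f) y = g y whenever a <= g y. In (i) and (iv) the identity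
   U1 (g e) f = U1 e (g f) makes the two formulas agree where they have to.
   In (ii) and (iii) both members of this identity turn out to equal a, so that
   U1 (g e) and U1 a coincide above a, and U1 (g f) and U1 a coincide below a;
   conversely, the identity is all that is needed to recover migrativity at
   mixed pairs x <= a <= y. *)
Require Import Defs.
From mathcomp Require Import all_boot all_order all_algebra.
From mathcomp Require Import interval_inference reals.

Set Implicit Arguments.
Unset Strict Implicit.
Unset Printing Implicit Defensive.

Import Order.TTheory.

Local Open Scope ring_scope.

Section TwoNeutral.

Variables (d : Order.disp_t) (T : orderType d) (U : T -> T -> T) (e f a : T).
Hypotheses (UC : commutative U) (UA : associative U).
Hypothesis U_homo : forall z, {homo U z : x y / (x <= y)%O}.
Hypotheses (le_ea : (e <= a)%O) (le_af : (a <= f)%O).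
Hypothesis Ue : forall x, (x <= a)%O -> U e x = x.
Hypothesis Uf : forall x, (a <= x)%O -> U f x = x.

Let U_homol z : {homo U^~ z : x y / (x <= y)%O}.
Proof. by move=> x y le_xy /=; rewrite !(UC _ z) U_homo. Qed.

(** Since [e <= a <= f], the product lies between [U e a = a] and [U a f = a]. *)
Lemma neutral_pair_mul : U e f = a.
Proof.
apply/le_anti/andP; split.
  by rewrite -[leRHS](Uf (lexx a)) [leLHS]UC U_homo.
by rewrite -[leLHS](Ue (lexx a)) U_homo.
Qed.

Lemma divider_idem : U a a = a.
Proof.
apply/le_anti/andP; split.
  by rewrite -[leRHS](Uf (lexx a)) U_homol.
by rewrite -[leLHS](Ue (lexx a)) U_homol.
Qed.

(** Below [a], [x = U e x], and this spare factor [e] turns [m] into [a]. *)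
Lemma absorb_lower m x : U e m = a -> (x <= a)%O -> U m x = U a x.
Proof. by move=> em xa; rewrite -em (UC e) -UA Ue. Qed.

Lemma absorb_upper l x : U l f = a -> (a <= x)%O -> U l x = U a x.
Proof. by move=> lf ax; rewrite -lf -UA Uf. Qed.

(** Settles the converses where [g] is a single translation, and pairs on one side of [a]. *)
Lemma mul_mem_migrative l x y : U (U l x) y = U x (U l y).
Proof. by rewrite (UC l) UA. Qed.

Section Map.

Variable g : T -> T.
Hypothesis g_homo : {homo g : x y / (x <= y)%O}.

Section Migrative.

Hypothesis g_migr : forall x y, U (g x) y = U x (g y).

Lemma migrative_low x : (g x <= a)%O -> U (g e) x = g x.
Proof. by move=> gxa; rewrite g_migr Ue. Qed.

Lemma migrative_high x : (a <= g x)%O -> U (g f) x = g x.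
Proof. by move=> agx; rewrite g_migr Uf. Qed.

Lemma migrative_all_low x : (g f <= a)%O -> U (g e) x = g x.
Proof.
move=> gfa; have [/migrative_low //|agx] := leP (g x) a.
(* Monotonicity of [g] pushes [x] above [f], so [x] absorbs the [f] in [g f = U (g e) f]. *)
have fx : (f <= x)%O.
  rewrite leNgt; apply: contraL agx => /ltW/g_homo/le_trans/(_ gfa).
  by rewrite -leNgt.
rewrite -(migrative_high (ltW agx)) -(migrative_low gfa) -UA Uf //.
exact: le_trans fx.
Qed.

Lemma migrative_all_high x : (a <= g e)%O -> U (g f) x = g x.
Proof.
move=> age; have [/migrative_high //|gxa] := leP a (g x).
have xe : (x <= e)%O.
  rewrite leNgt; apply: contraL gxa => /ltW/g_homo/(le_trans age).
  by rewrite -leNgt.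
rewrite -(migrative_low (ltW gxa)) -(migrative_high age) -UA Ue //.
exact: le_trans le_ea.
Qed.

(** If [g x] exceeds [a], then [g x = U (g f) x = U a x <= U a a = a], so [g x] can only be [a]. *)
Lemma migrative_below x : U (g e) f = a -> (x <= a)%O -> g x = U (g e) x.
Proof.
move=> lf xa; have [/migrative_low //|/ltW agx] := leP (g x) a.
suff gxa : g x = a by rewrite migrative_low // gxa.
apply/le_anti; rewrite agx andbT -(migrative_high agx).
by rewrite (absorb_lower _ xa) -?g_migr // -[leRHS]divider_idem U_homo.
Qed.

Lemma migrative_above x : U (g e) f = a -> (a <= x)%O -> g x = U (g f) x.
Proof.
move=> lf ax; have [/migrative_high //|/ltW gxa] := leP a (g x).
suff gxE : g x = a by rewrite migrative_high // gxE.
apply/le_anti; rewrite gxa /= -(migrative_low gxa).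
by rewrite (absorb_upper lf ax) -[leLHS]divider_idem U_homo.
Qed.

End Migrative.

Lemma piecewise_migrative l m :
    U l f = U e m ->
    (forall x, (x <= a)%O -> g x = U l x) ->
    (forall x, (a <= x)%O -> g x = U m x) ->
  forall x y, U (g x) y = U x (g y).
Proof.
move=> lf_em g_low g_high.
(* Writing [x = U e x] and [y = U f y] reduces both sides to [U x y] multiplied by [U l f] and by
   [U e m]. *)
have mixed x y : (x <= a)%O -> (a <= y)%O -> U (U l x) y = U x (U m y).
  move=> xa ay; rewrite -{1}(Uf ay) -{2}(Ue xa).
  by rewrite (UC l) -UA (UA l) lf_em (UC e x) -(UA e) -(UA x e).
move=> x y; case: (leP x a) => [xa|/ltW ax]; case: (leP y a) => [ya|/ltW ay].
- by rewrite !g_low // mul_mem_migrative.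
- by rewrite (g_low x) // (g_high y) // mixed.
- by rewrite (g_high x) // (g_low y) // UC -mixed // UC.
- by rewrite !g_high // mul_mem_migrative.
Qed.

End Map.

End TwoNeutral.

Theorem theorem3p1 (R : realType) (U1 U2 : {i01 R} -> {i01 R} -> {i01 R})
    (e1 f1 a1 e2 f2 a2 alpha : {i01 R})
    (hU1 : two_uninorm U1) (hn1 : two_neutral U1 e1 f1 a1)
    (hU2 : two_uninorm U2) (hn2 : two_neutral U2 e2 f2 a2) :
  let lam := U2 alpha e1 in
  let mu := U2 alpha f1 in
  [/\ (* (i) *)
      U2 alpha e1 <= e1 -> U2 alpha f1 <= a1 ->
      (migrative alpha U2 U1 <->
       forall x : {i01 R}, U1 lam x = U2 alpha x),
      (* (ii) *)
      U2 alpha e1 <= e1 -> a1 <= U2 alpha f1 ->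
      (migrative alpha U2 U1 <->
       [/\ forall x : {i01 R}, x <= a1 -> U2 alpha x = U1 lam x,
           forall x : {i01 R}, a1 <= x -> U2 alpha x = U1 mu x
         & forall x : {i01 R}, a1 <= x -> U1 lam x = U1 a1 x]),
      (* (iii) *)
      e1 <= U2 alpha e1 <= a1 ->
      (migrative alpha U2 U1 <->
       [/\ forall x : {i01 R}, x <= a1 -> U2 alpha x = U1 lam x,
           forall x : {i01 R}, a1 <= x -> U2 alpha x = U1 mu x
         & forall x : {i01 R}, x <= a1 -> U1 mu x = U1 a1 x])
    & (* (iv) *)
      a1 <= U2 alpha e1 ->
      (migrative alpha U2 U1 <->
       forall x : {i01 R}, U1 mu x = U2 alpha x)].
Proof.
move=> lam mu; case: hU1 => UC UA U1_incr _; case: hn1 => /andP[ea af] Ue Uf.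
have U1_homo z : {homo U1 z : x y / x <= y} by move=> x y /U1_incr-/(_ z)[].
have g_homo : {homo U2 alpha : x y / x <= y}.
  by case: hU2 => _ _ U2_incr _ x y /U2_incr-/(_ alpha)[].
have ef := neutral_pair_mul UC U1_homo ea af Ue Uf.
have aa := divider_idem UC U1_homo ea af Ue Uf.
have U1f_le x : x <= a1 -> U1 x f1 <= a1.
  by move=> xa; rewrite UC -[leRHS](Uf _ (lexx _)) U1_homo.
have U1e_ge x : a1 <= x -> a1 <= U1 e1 x.
  by move=> ax; rewrite -[leLHS](Ue _ (lexx _)) U1_homo.
split.
- move=> _ mu_a; split=> [M x|gE x y].
    exact: (migrative_all_low UA af Ue Uf g_homo M).
  by rewrite -!gE (mul_mem_migrative UC UA).
- move=> lam_e a_mu; split=> [M|[g_low g_high lamE]].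
    have lf : U1 lam f1 = a1.
      (* The upper bound uses [lam <= e1 <= a1]; the lower one trades [U1 lam f1] for [U1 e1 mu] by
         migrativity. *)
      apply/le_anti; rewrite U1f_le ?(le_trans lam_e) //=.
      by rewrite M U1e_ge.
    split=> x.
    + exact: (migrative_below UC UA U1_homo ea af Ue Uf M lf).
    + exact: (migrative_above UC UA U1_homo ea af Ue Uf M lf).
    + exact: (absorb_upper UA Uf lf).
  apply: (piecewise_migrative UC UA Ue Uf _ g_low g_high).
  rewrite lamE // UC Uf //; apply/le_anti; rewrite U1e_ge //=.
  (* The two formulas meet at [a1]: [U1 mu a1 = U1 lam a1 <= U1 e1 a1 = a1]. *)
  have mu_a : U1 mu a1 <= a1.
    rewrite -g_high // g_low // -[leRHS](Ue _ (lexx _)) !(UC _ a1).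
    exact: U1_homo.
  by apply: le_trans mu_a; rewrite !(UC _ mu) U1_homo.
- move=> /andP[e_lam lam_a].
  (* Here [e1 <= lam <= a1] alone squeezes the product between [U1 e1 f1] and [U1 a1 f1], so it
     serves both directions. *)
  have lf : U1 lam f1 = a1.
    apply/le_anti; rewrite U1f_le //= -[leLHS]ef !(UC _ f1).
    exact: U1_homo.
  split=> [M|[g_low g_high muE]].
    split=> x.
    + exact: (migrative_below UC UA U1_homo ea af Ue Uf M lf).
    + exact: (migrative_above UC UA U1_homo ea af Ue Uf M lf).
    + by apply: (absorb_lower UC UA Ue); rewrite -M.
  apply: (piecewise_migrative UC UA Ue Uf _ g_low g_high).
  by rewrite lf UC muE // UC Ue.
- move=> a_lam; split=> [M x|gE x y].
    exact: (migrative_all_high UA ea Ue Uf g_homo M).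
  by rewrite -!gE (mul_mem_migrative UC UA).
Qed.
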